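(* Let $\mathcal A$ be a model of cardinality $\omega_1$. If there is a model $\mathcal B$ of cardinality $>\omega_1$ such that $\mathcal A\equiv_{\omega_1}\mathcal B$, then $\mathcal A$ has exactly $2^{\omega_1}$ automorphisms.
   Context: Models are structures for a vocabulary of finitary relation and function symbols. A partial isomorphism between $\mathcal A$ and $\mathcal B$ is a partial map from the universe of $\mathcal A$ to that of $\mathcal B$ which preserves and reflects the truth of atomic formulas (including equalities). The Ehrenfeucht-Fraïssé game $G(\mathcal A,\mathcal B)$ of length $\omega_1$ between two models of the same vocabulary: two players $\exists$ and $\forall$ extend a countable partial isomorphism $\pi$ between $\mathcal A$ and $\mathcal B$. At the start $\pi=\emptyset$; at limit stages $\pi$ is the union of the earlier ones. At each of the $\omega_1$ moves, $\forall$ chooses an element in either $\mathcal A$ or $\mathcal B$, and then $\exists$ chooses an element in the other model. If $a\in\mathcal A$ and $b\in\mathcal B$ are the two chosen elements, then $\exists$ loses immediately if $\pi\cup\{(a,b)\}$ is not a partial isomorphism; otherwise $\pi\cup\{(a,b)\}$ is the new value of $\pi$ and the game continues. $\exists$ wins if he can move $\omega_1$ times without losing. We write $\mathcal A\equiv_{\omega_1}\mathcal B$ if $\exists$ has a winning strategy in $G(\mathcal A,\mathcal B)$. *)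

(* Defs.v *)
From HB Require Import structures.
From mathcomp Require Import all_boot.
From mathcomp Require Import boolp classical_sets functions cardinality.
From mathcomp Require Import wochoice.
Set Implicit Arguments.
Unset Strict Implicit.
Unset Printing Implicit Defensive.
Local Open Scope classical_set_scope.
Local Open Scope card_scope.

(* The first uncountable ordinal: well-order the (uncountable) set nat -> bool
   and keep the elements that have only countably many predecessors.  The
   lemmas below characterize the result up to isomorphism. *)
Definition wo_cantor : rel (nat -> bool) :=
  sval (well_ordering_principle (nat -> bool : eqType)).

Definition omega1 : Type :=
  {x : nat -> bool | countable [set y | wo_cantor y x]}.

Definition omega1_lt (i j : omega1) : Prop :=
  wo_cantor (sval i) (sval j) /\ i <> j.

Notation "i <1 j" := (omega1_lt i j) (at level 70, no associativity).

Lemma wo_cantor_min (P : set (nat -> bool)) :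
  P !=set0 -> exists2 x, P x & forall y, P y -> wo_cantor x y.
Proof.
move=> [x0 Px0].
have [|z [[Pz zmin] _]] :=
  svalP (well_ordering_principle (nat -> bool : eqType)) (fun x => `[< P x >]).
  by exists x0; apply/asboolP.
exists z; first exact/asboolP.
by move=> y Py; apply: zmin; apply/asboolP.
Qed.

Lemma wo_cantor_anti x y : wo_cantor x y -> wo_cantor y x -> x = y.
Proof.
have W := svalP (well_ordering_principle (nat -> bool : eqType)).
have W' : wo_chain wo_cantor predT.
  by move=> A _; apply: W.
by move=> xy yx; apply: (wo_chain_antisymmetric W') => //; apply/andP.
Qed.

Lemma wo_cantor_total x y : wo_cantor x y \/ wo_cantor y x.
Proof.
have [|z [->|->] zmin] := @wo_cantor_min [set z | z = x \/ z = y].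
- by exists x; left.
- by left; apply: zmin; right.
- by right; apply: zmin; left.
Qed.

Lemma wo_cantor_trans x y z : wo_cantor x y -> wo_cantor y z -> wo_cantor x z.
Proof.
move=> xy yz; have [|m Pm mmin] := @wo_cantor_min [set t | [\/ t = x, t = y | t = z]].
  by exists x; constructor 1.
case: Pm => mE; subst m.
- by apply: mmin; constructor 3.
- have yx : wo_cantor y x by apply: mmin; constructor 1.
  by rewrite (wo_cantor_anti xy yx).
- have zy : wo_cantor z y by apply: mmin; constructor 2.
  by rewrite -(wo_cantor_anti yz zy).
Qed.

Lemma omega1_inj (i j : omega1) : sval i = sval j -> i = j.
Proof. by case: i j => [x px] [y py] /= xy; subst y; congr exist; apply: Prop_irrelevance. Qed.

Lemma omega1_lt_irr i : ~ i <1 i.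
Proof. by case. Qed.

Lemma omega1_lt_trans i j k : i <1 j -> j <1 k -> i <1 k.
Proof.
move=> [ij nij] [jk njk]; split; first exact: wo_cantor_trans ij jk.
by move=> ik; subst k; apply: nij; apply: omega1_inj; apply: wo_cantor_anti.
Qed.

Lemma omega1_lt_total i j : [\/ i <1 j, i = j | j <1 i].
Proof.
have [->|nij] := pselect (i = j); first by apply: Or32.
have [ij|ji] := wo_cantor_total (sval i) (sval j); first exact: Or31.
by apply: Or33; split=> // e; apply: nij.
Qed.

Lemma omega1_lt_wf : well_founded omega1_lt.
Proof.
move=> [x0 px0]; apply: contrapT => nacc.
have [|x [px nx] xmin] :=
  @wo_cantor_min [set x | exists px, ~ Acc omega1_lt (exist _ x px)].
  by exists x0; exists px0.
apply: nx; constructor=> -[y py] [/= yx neq]; apply: contrapT => ny.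
have xy : wo_cantor x y by apply: xmin; exists py.
by apply: neq; apply: omega1_inj => /=; apply: wo_cantor_anti.
Qed.

Lemma omega1_countable_before i : countable [set j | j <1 i].
Proof.
have /countable_injP[f finj] := svalP i.
apply/countable_injP; exists (fun j => f (sval j)) => j k.
rewrite !inE => -[ji _] [ki _] /finj jk; apply: omega1_inj.
by apply: jk; rewrite inE.
Qed.

Lemma omega1_uncountable : ~ countable [set: omega1].
Proof.
move=> /countable_injP[f finj].
pose S := [set x : nat -> bool | countable [set y | wo_cantor y x]].
have cS : countable S.
  apply/countable_injP.
  exists (fun x => if pselect (S x) is left px then f (exist _ x px) else 0).
  move=> x y; rewrite !inE => Sx Sy.
  case: pselect => // px; case: pselect => // py /finj e.
  by have /(congr1 sval) := e (in_setT _) (in_setT _).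
have [|x nSx xmin] := @wo_cantor_min (~` S).
  apply: contrapT => ne.
  have allS x : x \in S by rewrite inE; apply: contrapT => nSx; apply: ne; exists x.
  have /countable_injP[g ginj] := cS.
  pose d n := `[< exists2 x : nat -> bool, g x = n & ~~ x n >].
  have [dn|dn] := boolP (d (g d)).
    move: (dn) => /asboolP[x gx].
    by have -> : x = d by [apply: ginj]; rewrite dn.
  by move/asboolP: (dn); apply; exists d.
apply: nSx; rewrite /S /=.
have cSx : countable (S `|` [set x]).
  rewrite -bigcup2E; apply: bigcup_countable => //.
  by move=> [|[|n]] _ //=; exact: countable1.
apply: (sub_countable _ cSx); apply: subset_card_le => y yx.
have [Sy|nSy] := pselect (S y); first by left.
by right; apply: wo_cantor_anti => //; apply: xmin.
Qed.

(* Function symbols of arity 0 are constant symbols. *)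
Record vocabulary := Vocabulary {
  relsym : Type; rel_arity : relsym -> nat;
  funsym : Type; fun_arity : funsym -> nat }.

Record structure (L : vocabulary) := Structure {
  carrier :> Type;
  rel_interp : forall r : relsym L, ('I_(rel_arity r) -> carrier) -> Prop;
  fun_interp : forall f : funsym L, ('I_(fun_arity f) -> carrier) -> carrier }.

Section Syntax.
Variables (L : vocabulary) (X : Type).

Inductive term :=
  | Var (x : X)
  | App (f : funsym L) (ts : 'I_(fun_arity f) -> term).

Variant atomic :=
  | Eq (t u : term)
  | Rel (r : relsym L) (ts : 'I_(rel_arity r) -> term).

Variable M : structure L.

Fixpoint eval (s : X -> M) (t : term) : M :=
  match t with
  | Var x => s x
  | App f ts => fun_interp (fun i => eval s (ts i))
  end.

Definition holds (s : X -> M) (phi : atomic) : Prop :=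
  match phi with
  | Eq t u => eval s t = eval s u
  | Rel r ts => rel_interp (fun i => eval s (ts i))
  end.

End Syntax.

Definition automorphisms (L : vocabulary) (M : structure L) : set (M -> M) :=
  [set h | [/\ bijective h,
    forall (r : relsym L) (x : 'I_(rel_arity r) -> M),
      rel_interp (h \o x) <-> rel_interp x &
    forall (f : funsym L) (x : 'I_(fun_arity f) -> M),
      h (fun_interp x) = fun_interp (h \o x)]].

Arguments automorphisms {L} M _.

Section Game.
Variables (L : vocabulary) (A B : structure L).

(* Partial maps are given by their graphs.  An atomic formula in n variables is
   evaluated at an n-tuple of elements of the domain; values of terms need not
   lie in the domain. *)
Definition partial_isomorphism (g : set (A * B)) : Prop :=
  (forall a b b', g (a, b) -> g (a, b') -> b = b') /\
  (forall n (s : 'I_n -> A) (t : 'I_n -> B), (forall i, g (s i, t i)) ->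
     forall phi : atomic L 'I_n, holds s phi <-> holds t phi).

(* The constructor records in which model the first player (forall) chose. *)
Variant round :=
  | ChoseLeft (a : A) (answer : B)
  | ChoseRight (b : B) (answer : A).

Definition round_pair (r : round) : A * B :=
  match r with ChoseLeft a b => (a, b) | ChoseRight b a => (a, b) end.

Definition history (i : omega1) : Type := {j : omega1 | j <1 i} -> round.

Definition play : Type := omega1 -> round.

Definition history_of (p : play) (i : omega1) : history i := fun j => p (sval j).

(* A strategy of the second player (exists): an answer to each choice of the
   first player at each move, depending on the earlier rounds. *)
Record strategy := Strategy {
  answer_left : forall i : omega1, history i -> A -> B;
  answer_right : forall i : omega1, history i -> B -> A }.

Definition follows (sigma : strategy) (p : play) : Prop :=
  forall i, match p i with
    | ChoseLeft a b => b = answer_left sigma (@history_of p i) a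
    | ChoseRight b a => a = answer_right sigma (@history_of p i) b
    end.

Definition position (p : play) (i : omega1) : set (A * B) :=
  [set round_pair (p j) | j in [set j | j <1 i]].

Definition loses_at (p : play) (i : omega1) : Prop :=
  ~ partial_isomorphism (position p i `|` [set round_pair (p i)]).

(* Since a strategy answers after every history, a run that reaches a losing
   move extends to a play of full length; so it suffices to consider these. *)
Definition winning (sigma : strategy) : Prop :=
  forall p, follows sigma p -> forall i, ~ loses_at p i.

Definition ef_equivalent : Prop := exists sigma, winning sigma.

End Game.

(* Main.v *)
(* Fix a winning strategy of the second player and run two plays [p], [q] of the
   game side by side.  They give partial isomorphisms [f], [g] from [A] to [B];
   if both become total on [A] with equal ranges, [g^-1 o f] is an automorphism.
   At any position two different elements of [B] ("twins") get the same answer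
   in [A], since [B] does not inject into [A].  Offering [p] one of the twins
   according to a bit, and [q] always the first one, makes the automorphism
   remember the bit, so the omega1-sequences of bits inject into the
   automorphisms.  Comparing with [A] through [B] in this way, instead of fixing
   a submodel of [B] of size omega1, avoids any use of CH. *)
Require Import Defs.
From mathcomp Require Import all_boot.
From mathcomp Require Import boolp classical_sets functions cardinality.
Set Implicit Arguments.
Unset Strict Implicit.
Unset Printing Implicit Defensive.
Local Open Scope classical_set_scope.
Local Open Scope card_scope.

(** * Injections, countable bounds, recursion and pairing on [omega1] *)

Lemma card_le_setT_inj (T U : Type) :
  [set: T] #<= [set: U] -> exists f : T -> U, injective f.
Proof.
move=> /card_leP[f].
exists (fun x => set_val (f (SigSub (mem_set (I : [set: T] x))))) => x y.
move=> /val_inj /(inj (mem_set I) (mem_set I)).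
by move=> /(congr1 (@set_val _ _)).
Qed.

Lemma inj_retraction (T U : Type) (f : T -> U) (t0 : T) :
  injective f -> exists r, forall t, r (f t) = t.
Proof.
move=> finj; have [r rP] : {r : U -> T & forall u t, f t = u -> r u = t}.
  apply: (@choice _ _ (fun u t => forall t', f t' = u -> t = t')) => u.
  have [[t <-]|nt] := pselect (exists t, f t = u); first by exists t => t' /finj.
  by exists t0 => t ft; case: nt; exists t.
by exists r => t; exact: rP.
Qed.

Lemma inj_card_le_sub (T U : Type) (X : set T) (Y : set U) (f : T -> U) :
  {in X &, injective f} -> f @` X `<=` Y -> X #<= Y.
Proof.
move=> finj fXY; apply: card_le_trans (subset_card_le fXY).
by have := inj_card_eq finj; rewrite card_eq_le => /andP[].
Qed.

Lemma countable_setU (T : Type) (X Y : set T) :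
  countable X -> countable Y -> countable (X `|` Y).
Proof.
by move=> cX cY; rewrite -bigcup2E; apply: bigcup_countable => // -[|[|n]] _ /=.
Qed.

(** Regularity: without a strict bound, the closed initial segments ending in members of [C] would
    cover [omega1], a countable union of countable sets. *)
Lemma omega1_countable_bounded (C : set omega1) :
  countable C -> exists i, forall j, C j -> j <1 i.
Proof.
move=> cC; apply: contrapT => nb; apply: omega1_uncountable.
have cU : countable (\bigcup_(j in C) ([set k | k <1 j] `|` [set j])).
  apply: bigcup_countable => // j _; apply: countable_setU; last exact: countable1.
  exact: omega1_countable_before.
apply: (sub_countable _ cU); apply: subset_card_le => k _.
apply: contrapT => nk; apply: nb; exists k => j Cj.
by case: (omega1_lt_total j k) => // h; case: nk; exists j => //=; [right|left].
Qed.

Lemma omega1_rec (T : Type) (F : forall i, ({j | j <1 i} -> T) -> T) :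
  exists f : omega1 -> T, forall i, f i = F i (fun j => f (sval j)).
Proof.
pose step i (h : forall j, j <1 i -> T) := F i (fun j => h (sval j) (svalP j)).
exists (Fix omega1_lt_wf (fun=> T) step) => i.
rewrite (Fix_eq omega1_lt_wf (fun=> T)) // => k f g fg.
by congr F; apply: funext => j; apply: fg.
Qed.

Lemma omega1_nat_inj_avoid (C : set omega1) : countable C ->
  exists g : nat -> omega1, injective g /\ forall n, ~ C (g n).
Proof.
move=> cC; have : infinite_set (~` C).
  move=> /finite_set_countable cC'; apply: omega1_uncountable.
  by rewrite -(setUv C); apply: countable_setU.
move=> /infiniteP/card_leP[g].
exists (fun n => set_val (g (SigSub (mem_set (I : [set: nat] n))))); split.
  move=> m n /val_inj /(inj (mem_set I) (mem_set I)).
  by move=> /(congr1 (@set_val _ _)).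
by move=> n; exact: (set_valP (g _)).
Qed.

(* Pick injections [G i : nat -> omega1] with pairwise disjoint ranges; a pair
   with maximum [i] goes into the range of [G i], even and odd numbers recording
   which component is the maximum. *)
Lemma omega1_square_inj : exists g : omega1 -> omega1 -> omega1,
  forall i j i' j', g i j = g i' j' -> i = i' /\ j = j'.
Proof.
have [pick pickP] : {pick : set omega1 -> nat -> omega1 & forall C, countable C ->
    injective (pick C) /\ forall n, ~ C (pick C n)}.
  apply: (@choice _ _ (fun C g => countable C -> injective g /\ forall n, ~ C (g n))).
  move=> C; have [cC|ncC] := pselect (countable C).
    by have [g gP] := omega1_nat_inj_avoid cC; exists g.
  (* Arbitrary default for uncountable [C]; only the countable sets [used i G] matter. *)
  by have [g _] := omega1_nat_inj_avoid (countable0 _); exists g.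
pose used i (h : omega1 -> nat -> omega1) := \bigcup_(j in [set j | j <1 i]) range (h j).
have [G GE] : exists G : omega1 -> nat -> omega1, forall i, G i = pick (used i G).
  have [G GE] := @omega1_rec (nat -> omega1) (fun i h =>
    pick (\bigcup_(j in [set: {j | j <1 i}]) range (h j))).
  exists G => i; rewrite [LHS]GE; congr pick; apply/seteqP; split.
    by move=> x [[j ji] _ /= xj]; exists j.
  by move=> x [j ji xj]; exists (exist _ j ji).
have cused i : countable (used i G).
  apply: bigcup_countable => [|j _]; first exact: omega1_countable_before.
  by apply: (sub_countable (card_image_le _ _)); exact: countableP.
have Ginj i : injective (G i) by rewrite GE; case: (pickP _ (cused i)).
have Gdisj i j m n : G i m = G j n -> i = j.
  have lt i' j' m' n' : i' <1 j' -> G i' m' <> G j' n'.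
    move=> ij e; have [_ /(_ n')] := pickP _ (cused j').
    by rewrite -GE -e; apply; exists i'.
  by move=> e; case: (omega1_lt_total i j) => [h|//|h];
    [case: (lt _ _ _ _ h e)|case: (lt _ _ _ _ h (esym e))].
(* [c i] numbers the countable closed initial segment up to [i]. *)
have [c cP] : {c : omega1 -> omega1 -> nat & forall i,
    {in [set j | j = i \/ j <1 i] &, injective (c i)}}.
  apply: (@choice _ _ (fun i ci => {in [set j | j = i \/ j <1 i] &, injective ci})).
  move=> i; apply/countable_injP; apply: countable_setU; first exact: countable1.
  exact: omega1_countable_before.
exists (fun i j => if pselect (i <1 j) then G j (c j i).*2.+1 else G i (c i j).*2).
have eqn_odd m n : m.*2 <> n.*2.+1 by move/(congr1 odd); rewrite /= !odd_double.
have nlt i j : ~ i <1 j -> j = i \/ j <1 i.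
  by move=> nij; case: (omega1_lt_total i j) => // [->|]; [left|right].
move=> i j i' j'; case: pselect => ij; case: pselect => ij' e;
  have ? := Gdisj _ _ _ _ e; subst; move: e => /Ginj.
- by move=> [] /double_inj /cP; rewrite !inE => /(_ (or_intror ij) (or_intror ij')).
- by move=> e; case: (eqn_odd _ _ (esym e)).
- by move=> /eqn_odd.
- by move=> /double_inj /cP; rewrite !inE => /(_ (nlt _ _ ij) (nlt _ _ ij')).
Qed.

(** Each [t] owns the row [g (c t)] of the pairing; being uncountable, the row cannot stay inside
    the countable set of indices up to [k]. *)
Lemma omega1_cofinal_enum (T : Type) (c : T -> omega1) (t0 : T) : injective c ->
  exists e : omega1 -> T, forall t k, exists i, k <1 i /\ e i = t.
Proof.
move=> cinj; have [g gP] := omega1_square_inj.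
have [e eP] : {e : omega1 -> T & forall i t l, i = g (c t) l -> e i = t}.
  apply: (@choice _ _ (fun i u => forall t l, i = g (c t) l -> u = t)) => i.
  have [[t [l ->]]|nt] := pselect (exists t l, i = g (c t) l).
    by exists t => t' l' /gP[/cinj].
  by exists t0 => t l il; case: nt; exists t, l.
exists e => t k.
have [[l kl]|nl] := pselect (exists l, k <1 g (c t) l).
  by exists (g (c t) l); split=> //; apply: eP.
case: omega1_uncountable.
have cU := countable_setU (omega1_countable_before k) (countable1 k).
apply: (sub_countable _ cU); apply: (@inj_card_le_sub _ _ _ _ (g (c t))).
  by move=> l l' _ _ /gP[].
move=> _ [l _ <-]; case: (omega1_lt_total k (g (c t) l)) => [h|<-|h].
- by case: nl; exists l.
- by right.
- by left.
Qed.

(* [Cover k]: both plays take the [k]-th element of [A].  [Merge k]: each play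
   takes the element of [B] that occurred in move [k] of the other one.
   [Split k]: the [k]-th bit is encoded. *)
Variant task := Cover of omega1 | Merge of omega1 | Split of omega1.

Lemma task_enum :
  exists e : omega1 -> task, forall t k, exists i, k <1 i /\ e i = t.
Proof.
have [g gP] := omega1_square_inj.
have [w [winj _]] := omega1_nat_inj_avoid (countable0 _).
(* The distinct tags [w 0], [w 1], [w 2] keep the three kinds of task apart. *)
pose c t := match t with
  Cover k => g (w 0) k | Merge k => g (w 1) k | Split k => g (w 2) k end.
apply: (@omega1_cofinal_enum _ c (Cover (w 0))).
by case=> k [] l /gP[] // /winj // _ ->.
Qed.

(** * From partial isomorphisms to embeddings and automorphisms *)

Section Embeddings.
Variables (L : vocabulary) (A B : structure L).

Record embedding (f : A -> B) : Prop := Embedding {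
  embedding_inj : injective f;
  embedding_rel : forall (r : relsym L) (x : 'I_(rel_arity r) -> A),
    rel_interp (f \o x) <-> rel_interp x;
  embedding_fun : forall (h : funsym L) (x : 'I_(fun_arity h) -> A),
    f (fun_interp x) = fun_interp (f \o x) }.

(** Reflection of the atomic formula [v0 = v1] yields this. *)
Lemma partial_isomorphism_inj (g : set (A * B)) a a' b :
  partial_isomorphism g -> g (a, b) -> g (a', b) -> a = a'.
Proof.
move=> [_ gP] gab ga'b.
pose s (i : 'I_2) := if i == ord0 then a else a'.
have gs i : g (s i, b) by rewrite /s; case: ifP.
have := gP 2 s (fun=> b) gs (Eq (Var L ord0) (Var L ord_max)).
by rewrite /s /= => -[_]; apply.
Qed.

Lemma partial_isomorphism_embedding (g : set (A * B)) (f : A -> B) :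
  partial_isomorphism g -> (forall a, g (a, f a)) -> embedding f.
Proof.
move=> gP gf; have [_ gat] := gP; split.
- move=> a a' e; apply: (partial_isomorphism_inj gP (gf a)); rewrite e; exact: gf.
- move=> r x.
  have [? ?] := gat _ x (f \o x) (fun i => gf (x i)) (Rel (fun i => Var L i)).
  by split.
- move=> h x.
  (* Assignment for the formula [v0 = h(v1, ..., vn)]: slot 0 holds the value of [h], which lies in
     the domain because [g] is total on [A]. *)
  pose s (i : 'I_(fun_arity h).+1) :=
    if unlift ord0 i is Some j then x j else fun_interp x.
  have := gat _ s (f \o s) (fun i => gf (s i))
    (Eq (Var L ord0) (App (fun i => Var L (lift ord0 i)))).
  rewrite /= /s unlift_none.
  have E : (fun i : 'I_(fun_arity h) =>
    if unlift ord0 (lift ord0 i) is Some j then x j else fun_interp x) = x.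
    by apply: funext => i; rewrite liftK.
  rewrite E => -[/(_ erefl) -> _]; congr fun_interp.
  by apply: funext => i; rewrite /= liftK.
Qed.

(** Equal ranges make [g^-1 o f] and [f^-1 o g] total and mutually inverse; the symbols are compared
    inside [B], after composing with [g]. *)
Lemma embedding_pair_automorphism (f g : A -> B) : embedding f -> embedding g ->
  range f = range g -> exists h, automorphisms A h /\ forall a, g (h a) = f a.
Proof.
move=> ef eg fg.
have [h hP] : {h : A -> A & forall a, g (h a) = f a}.
  apply: (@choice _ _ (fun a a' => g a' = f a)) => a.
  have [a' _ ?] : range g (f a) by rewrite -fg; exists a.
  by exists a'.
have [k kP] : {k : A -> A & forall a, f (k a) = g a}.
  apply: (@choice _ _ (fun a a' => f a' = g a)) => a.
  have [a' _ ?] : range f (g a) by rewrite fg; exists a.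
  by exists a'.
have ghx (n : nat) (x : 'I_n -> A) : g \o (h \o x) = f \o x.
  by apply: funext => i; rewrite /= hP.
exists h; split=> //; split.
- exists k => a; first by apply: (embedding_inj ef); rewrite kP hP.
  by apply: (embedding_inj eg); rewrite hP kP.
- move=> r x; rewrite -(embedding_rel eg) ghx.
  exact: embedding_rel ef _ _.
- move=> s x; apply: (embedding_inj eg).
  by rewrite hP (embedding_fun ef) (embedding_fun eg) ghx.
Qed.

End Embeddings.

(** * Partial isomorphisms from plays of full length *)

Section Plays.
Variables (L : vocabulary) (A B : structure L).

Definition play_graph (p : play A B) : set (A * B) := range (fun i => round_pair (p i)).

(** Each condition concerns finitely many pairs, which all occur before some stage [k], and the
    position at [k] is a partial isomorphism. *)
Lemma winning_play_graph (sigma : strategy A B) (p : play A B) :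
  winning sigma -> follows sigma p -> partial_isomorphism (play_graph p).
Proof.
move=> win fol.
have iso i : partial_isomorphism (position p i `|` [set round_pair (p i)]).
  by apply: contrapT; exact: win.
have bound (D : set omega1) : countable D -> exists i, forall j, D j ->
    (position p i `|` [set round_pair (p i)]) (round_pair (p j)).
  move=> /omega1_countable_bounded[i iD]; exists i => j /iD ji.
  by left; exists j.
split.
- move=> a b b' [i _ pi] [j _ pj].
  have [|k kP] := bound [set i; j].
    by apply: countable_setU; exact: countable1.
  apply: ((iso k).1 a); first by rewrite -pi; apply: kP; left.
  by rewrite -pj; apply: kP; right.
- move=> n s t st phi.
  have [m mP] : {m : 'I_n -> omega1 & forall i, round_pair (p (m i)) = (s i, t i)}.
    apply: (@choice _ _ (fun i j => round_pair (p j) = (s i, t i))) => i.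
    by have [j _ jE] := st i; exists j.
  have [|k kP] := bound (range m).
    by apply: (sub_countable (card_image_le _ _)); exact: countableP.
  by apply: (iso k).2 => i; rewrite -mP; apply: kP; exists i.
Qed.

End Plays.

(** * Two parallel plays encoding a sequence of bits *)

Section TwinPlays.
Variables (L : vocabulary) (A B : structure L) (sigma : strategy A B).
Hypothesis win : winning sigma.
Variables (a_ : omega1 -> A) (tasks : omega1 -> task).
Hypothesis a_surj : forall a, exists k, a_ k = a.
Hypothesis tasks_cofinal : forall t k, exists i, k <1 i /\ tasks i = t.
Variable twins : forall i, history A B i -> B * B.
Hypothesis twins_neq : forall i (h : history A B i), (twins h).1 <> (twins h).2.
Hypothesis twins_answer : forall i (h : history A B i),
  answer_right sigma h (twins h).1 = answer_right sigma h (twins h).2.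

Definition play_left i (h : history A B i) (a : A) : round A B :=
  ChoseLeft a (answer_left sigma h a).

Definition play_right i (h : history A B i) (b : B) : round A B :=
  ChoseRight b (answer_right sigma h b).

Definition twin_step (s : omega1 -> bool) i
    (h : {j | j <1 i} -> round A B * round A B) : round A B * round A B :=
  let p : history A B i := fun j => (h j).1 in
  let q : history A B i := fun j => (h j).2 in
  match tasks i with
  | Cover k => (play_left p (a_ k), play_left q (a_ k))
  | Merge k =>
      if pselect (k <1 i) is left ki then
        let r := h (exist _ k ki) in
        (play_right p (round_pair r.2).2, play_right q (round_pair r.1).2)
      (* Filler when move [k] is not yet past; [Merge k] recurs at a later move. *)
      else (play_left p (a_ k), play_left q (a_ k))
  | Split k =>
      (play_right p (if s k then (twins p).1 else (twins p).2),
       play_right q (twins p).1)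
  end.

Definition twin_plays (s : omega1 -> bool) (pq : omega1 -> round A B * round A B) :=
  forall i, pq i = twin_step s (fun j : {j | j <1 i} => pq (sval j)).

Let fst_play (pq : omega1 -> round A B * round A B) : play A B := fun i => (pq i).1.
Let snd_play (pq : omega1 -> round A B * round A B) : play A B := fun i => (pq i).2.

Lemma twin_plays_follow s pq : twin_plays s pq ->
  follows sigma (fst_play pq) /\ follows sigma (snd_play pq).
Proof.
move=> pqE; split=> i; rewrite /fst_play /snd_play pqE /twin_step;
  by case: (tasks i) => k //=; case: pselect.
Qed.

Lemma twin_plays_total s pq a : twin_plays s pq ->
  (exists b, play_graph (fst_play pq) (a, b)) /\
  (exists b, play_graph (snd_play pq) (a, b)).
Proof.
move=> pqE; have [k <-] := a_surj a; have [i [_ ti]] := tasks_cofinal (Cover k) k.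
split; eexists; exists i => //; by rewrite /fst_play /snd_play pqE /twin_step ti.
Qed.

(** An element of [B] entering one play at move [k] is copied into the other at a later move with
    task [Merge k]. *)
Lemma twin_plays_range s pq b : twin_plays s pq ->
  (exists a, play_graph (fst_play pq) (a, b)) <->
  (exists a, play_graph (snd_play pq) (a, b)).
Proof.
move=> pqE; split=> -[a [k _ kE]];
  have [i [ki ti]] := tasks_cofinal (Merge k) k;
  eexists; exists i => //; rewrite /fst_play /snd_play pqE /twin_step ti;
  case: pselect => //= _; by move: kE; rewrite /fst_play /snd_play => ->.
Qed.

Lemma twin_plays_automorphism s pq : twin_plays s pq ->
  exists h, automorphisms A h /\ forall a b, play_graph (fst_play pq) (a, b) <->
    play_graph (snd_play pq) (h a, b).
Proof.
move=> pqE; have [fp fq] := twin_plays_follow pqE.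
have ip := winning_play_graph win fp; have iq := winning_play_graph win fq.
have [f fP] := choice (fun a => (twin_plays_total a pqE).1).
have [g gP] := choice (fun a => (twin_plays_total a pqE).2).
have fE a b : play_graph (fst_play pq) (a, b) <-> f a = b.
  by split=> [|<-//]; apply: ip.1.
have gE a b : play_graph (snd_play pq) (a, b) <-> g a = b.
  by split=> [|<-//]; apply: iq.1.
have [|h [ha hE]] := embedding_pair_automorphism
  (partial_isomorphism_embedding ip fP) (partial_isomorphism_embedding iq gP).
  apply/seteqP; split=> b [a _] ab.
    have [|a' /gE] := (twin_plays_range b pqE).1; last by exists a'.
    by exists a; apply/fE.
  have [|a' /fE] := (twin_plays_range b pqE).2; last by exists a'.
  by exists a; apply/gE.
by exists h; split=> // a b; rewrite fE gE hE.
Qed.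

(* The first play answers both twins by the same [a], and the second play answers
   the first twin by [a1]; hence [h] sends [a] to [a1] exactly when the first
   play was given the first twin. *)
Lemma twin_plays_bit s pq h i k : twin_plays s pq ->
  (forall a b, play_graph (fst_play pq) (a, b) <-> play_graph (snd_play pq) (h a, b)) ->
  tasks i = Split k ->
  let p : history A B i := fun j => (pq (sval j)).1 in
  let q : history A B i := fun j => (pq (sval j)).2 in
  s k = `[< h (answer_right sigma p (twins p).1) = answer_right sigma q (twins p).1 >].
Proof.
move=> pqE hE ti p q; have [fp fq] := twin_plays_follow pqE.
have ip := winning_play_graph win fp; have iq := winning_play_graph win fq.
have ga1 : play_graph (snd_play pq) (answer_right sigma q (twins p).1, (twins p).1).
  by exists i; rewrite // /snd_play pqE /twin_step ti.
have ga : play_graph (fst_play pq) (answer_right sigma p (twins p).1,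
    if s k then (twins p).1 else (twins p).2).
  exists i; rewrite // /fst_play pqE /twin_step ti /=; congr pair.
  by case: (s k); rewrite ?twins_answer.
apply/idP/asboolP => [sk|ha].
  by apply: (partial_isomorphism_inj iq) ga1; apply/hE; move: ga; rewrite sk.
apply: contrapT => /negP/negbTE sk; move: ga; rewrite sk => ga.
apply: (@twins_neq _ p); apply: ip.1 ga.
by apply/hE; rewrite ha.
Qed.

(** The twins depend on earlier bits, so decoding goes by induction on moves: equal histories give
    equal twins, and then [h] determines the bit used next. Once the plays coincide, so do all
    bits. *)
Lemma twin_plays_separate s s' pq pq' h : twin_plays s pq -> twin_plays s' pq' ->
  (forall a b, play_graph (fst_play pq) (a, b) <-> play_graph (snd_play pq) (h a, b)) ->
  (forall a b, play_graph (fst_play pq') (a, b) <-> play_graph (snd_play pq') (h a, b)) ->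
  s = s'.
Proof.
move=> pqE pqE' hE hE'.
suff agree i : pq i = pq' i.
  apply: funext => k; have [i [_ ti]] := tasks_cofinal (Split k) k.
  have E : pq = pq' by apply: funext.
  by rewrite (twin_plays_bit pqE hE ti) (twin_plays_bit pqE' hE' ti) E.
elim/(well_founded_ind omega1_lt_wf) : i => i IH.
have E : (fun j : {j | j <1 i} => pq (sval j)) = (fun j => pq' (sval j)).
  by apply: funext => -[j ji] /=; apply: IH.
(* Only [Split] consults the bits; the other tasks follow from equal histories. *)
rewrite pqE pqE' E /twin_step; case ti : (tasks i) => [k|k|k] //.
rewrite (twin_plays_bit pqE hE ti) (twin_plays_bit pqE' hE' ti) /=.
pose hist (f : {j | j <1 i} -> round A B * round A B) := (fun j => (f j).1, fun j => (f j).2).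
have [-> ->] := (congr1 hist E).
by [].
Qed.

Lemma twin_automorphisms : [set: omega1 -> bool] #<= automorphisms A.
Proof.
have [pq pqE] := choice (fun s => omega1_rec (twin_step s)).
have [h hP] := choice (fun s => twin_plays_automorphism (pqE s)).
apply: (@inj_card_le_sub _ _ _ _ h) => [s s' _ _ e|_ [s _ <-]].
  apply: twin_plays_separate (pqE s) (pqE s') (hP s).2 _.
  by rewrite e; exact: (hP s').2.
exact: (hP s).1.
Qed.

End TwinPlays.

(** * The upper bound and the final count *)

(** A function is coded by the characteristic function of its graph, through the pairing [g]. *)
Lemma omega1_functions_le : [set: omega1 -> omega1] #<= [set: omega1 -> bool].
Proof.
have [g gP] := omega1_square_inj.
apply: (@inj_card_le_sub _ _ _ _ (fun f i => `[< exists j, i = g j (f j) >])) => //.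
move=> f f' _ _ e; apply: funext => j.
have : `[< exists l, g j (f j) = g l (f' l) >].
  by rewrite -(congr1 (fun u => u (g j (f j))) e); apply/asboolP; exists j.
by move=> /asboolP[l /gP[<-]].
Qed.

Lemma card_functions_le (A : Type) : [set: A] #= [set: omega1] ->
  [set: A -> A] #<= [set: omega1 -> omega1].
Proof.
rewrite card_eq_le => /andP[/card_le_setT_inj[u uinj] /card_le_setT_inj[v vinj]].
have [a0] : inhabited A.
  have [w _] := omega1_nat_inj_avoid (countable0 _).
  by exists; exact: v (w 0).
have [r rP] := inj_retraction a0 uinj.
apply: (@inj_card_le_sub _ _ _ _ (fun f i => u (f (r i)))) => // f f' _ _ e.
apply: funext => a; apply: uinj.
by have := congr1 (fun w => w (u a)) e; rewrite !rP.
Qed.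

Theorem theorem1 (L : vocabulary) (A : structure L)
  (hA : [set: A] #= [set: omega1])
  (hB : exists B : structure L,
    [/\ [set: omega1] #<= [set: B], [set: B] #!= [set: omega1] &
        ef_equivalent A B]) :
  automorphisms A #= [set: omega1 -> bool].
Proof.
have [B [leB neB [sigma win]]] := hB.
apply: Cantor_Bernstein.
  (* Upper bound: automorphisms are among all maps from [A] to [A]. *)
  apply: card_le_trans (card_leT _) _.
  exact: card_le_trans (card_functions_le hA) omega1_functions_le.
have [leA geA] : [set: A] #<= [set: omega1] /\ [set: omega1] #<= [set: A].
  by apply/andP; rewrite -card_eq_le.
have [a_ a_surj] : exists a_ : omega1 -> A, forall a, exists k, a_ k = a.
  have [u uinj] := card_le_setT_inj leA.
  have [v _] := card_le_setT_inj geA.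
  have [w _] := omega1_nat_inj_avoid (countable0 _).
  have [r rP] := inj_retraction (v (w 0)) uinj.
  by exists r => a; exists (u a); exact: rP.
have [tasks tasks_cofinal] := task_enum.
(* If the answers at some history had no twins, they would inject [B] into [A], contradicting [neB].
   Packing the stage with its history lets one use of choice serve all stages. *)
have twin (ih : {i & history A B i}) : exists b : B * B, b.1 <> b.2 /\
    answer_right sigma (projT2 ih) b.1 = answer_right sigma (projT2 ih) b.2.
  apply: contrapT => nb; move/negP: neB; apply.
  rewrite card_eq_le leB andbT; apply: card_le_trans leA.
  apply: (@inj_card_le_sub _ _ _ _ (answer_right sigma (projT2 ih))) => // b b' _ _ e.
  by apply: contrapT => bb'; apply: nb; exists (b, b').
have [twins twinsP] := choice twin.
apply: (@twin_automorphisms _ _ _ _ win _ _ a_surj tasks_cofinal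
  (fun i h => twins (existT _ i h))) => i h.
  exact: (twinsP (existT _ i h)).1.
exact: (twinsP (existT _ i h)).2.
Qed.
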